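(* Let $M(f_1,\ldots,f_6)$ be a generalized $(\kappa,\mu)$-space form which is also a contact metric manifold. Then, for all vector fields $X,Y$ orthogonal to $\xi$, $$R(X,\phi X,Y,\phi Y)=R(X,Y,X,Y)+R(X,\phi Y,X,\phi Y)-2(f_1-f_2)P(X,Y,X,\phi Y)-2f_4P(X,Y,hX,\phi Y).$$
   Context: All functions and tensors are smooth. An almost contact metric manifold $(M,\phi,\xi,\eta,g)$ is an odd-dimensional Riemannian manifold $(M,g)$ with a $(1,1)$-tensor field $\phi$, a vector field $\xi$ and a 1-form $\eta$ with $\eta(\xi)=1$, $\phi^2X=-X+\eta(X)\xi$, $g(\phi X,\phi Y)=g(X,Y)-\eta(X)\eta(Y)$. It is a contact metric manifold if $d\eta(X,Y)=g(X,\phi Y)$, with the convention $2\,d\eta(X,Y)=X\eta(Y)-Y\eta(X)-\eta([X,Y])$. Put $h=\tfrac12 L_\xi\phi$ ($L$ the Lie derivative). The curvature is $R(X,Y)Z=\nabla_X\nabla_YZ-\nabla_Y\nabla_XZ-\nabla_{[X,Y]}Z$ and $R(X,Y,Z,W)=g(R(X,Y)Z,W)$. Define $P(X,Y,Z,W)=g(X,\phi Z)g(Y,W)-g(X,\phi W)g(Y,Z)-g(Y,\phi Z)g(X,W)+g(Y,\phi W)g(X,Z)$. An almost contact metric manifold is a generalized $(\kappa,\mu)$-space form, denoted $M(f_1,\ldots,f_6)$, if there are functions $f_1,\ldots,f_6$ on $M$ with $R=\sum_{i=1}^6 f_iR_i$, where $R_1(X,Y)Z=g(Y,Z)X-g(X,Z)Y$;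 $R_2(X,Y)Z=g(X,\phi Z)\phi Y-g(Y,\phi Z)\phi X+2g(X,\phi Y)\phi Z$; $R_3(X,Y)Z=\eta(X)\eta(Z)Y-\eta(Y)\eta(Z)X+g(X,Z)\eta(Y)\xi-g(Y,Z)\eta(X)\xi$; $R_4(X,Y)Z=g(Y,Z)hX-g(X,Z)hY+g(hY,Z)X-g(hX,Z)Y$; $R_5(X,Y)Z=g(hY,Z)hX-g(hX,Z)hY+g(\phi hX,Z)\phi hY-g(\phi hY,Z)\phi hX$; $R_6(X,Y)Z=\eta(X)\eta(Z)hY-\eta(Y)\eta(Z)hX+g(hX,Z)\eta(Y)\xi-g(hY,Z)\eta(X)\xi$. *)

(* Defs.v *)
From HB Require Import structures.
From mathcomp Require Import all_boot all_order all_algebra.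
From mathcomp Require Import all_classical all_reals all_analysis.
Import Order.TTheory GRing.Theory Num.Theory.
Import numFieldNormedType.Exports.

Set Implicit Arguments.
Unset Strict Implicit.
Unset Printing Implicit Defensive.

From mathcomp Require Import ring.

Local Open Scope classical_set_scope.
Local Open Scope ring_scope.

Lemma near_eq_continuous (T U : topologicalType) (f g : T -> U) (x : T) :
  (\forall y \near x, f y = g y) ->
  {for x, continuous f} -> {for x, continuous g}.
Proof.
move=> fg; rewrite /prop_for /continuous_at -(nbhs_singleton fg) => cf.
by apply: cvg_trans cf; exact: near_eq_cvg.
Qed.

Section SmoothOn.
Context {R : realType} {n : nat}.
Implicit Types (U : set 'rV[R]_n) (f g : 'rV[R]_n -> R).

Definition partial (i : 'I_n) f : 'rV[R]_n -> R :=
  fun x => 'D_(delta_mx 0 i) f x.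

(* All partial derivatives of order <= k exist and are continuous on U. *)
Fixpoint Ck_on (k : nat) U f : Prop :=
  (forall x, U x -> {for x, continuous f}) /\
  match k with
  | 0 => True
  | k'.+1 => forall i : 'I_n,
      (forall x, U x -> derivable f x (delta_mx 0 i)) /\
      Ck_on k' U (partial i f)
  end.

Definition smooth_on U f : Prop := forall k, Ck_on k U f.

Lemma Ck_onW k U f : Ck_on k.+1 U f -> Ck_on k U f.
Proof.
elim: k f => [|k IH] f [cf df]; first by split.
by split=> // i; have [dfi Cfi] := df i; split=> //; exact: IH.
Qed.

Lemma eq_Ck_on k U f g : open U -> (forall x, U x -> f x = g x) ->
  Ck_on k U f -> Ck_on k U g.
Proof.
move=> oU; elim: k f g => [|k IH] f g fg.
all: have nfg x : U x -> \forall y \near x, f y = g y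
  by move=> Ux; apply: filterS (open_nbhs_nbhs (conj oU Ux)) => y; exact: fg.
all: case=> cf df; split=> [x Ux|].
- by apply: near_eq_continuous (cf x Ux) => //; exact: nfg.
- by [].
- by apply: near_eq_continuous (cf x Ux) => //; exact: nfg.
- move=> i; have [dfi Cfi] := df i; split=> [x Ux|].
    by apply: near_eq_derivable (dfi x Ux); exact: nfg.
  apply: IH Cfi => x Ux; apply: near_eq_derive; exact: nfg.
Qed.

Lemma Ck_on_cst k U (a : R) : Ck_on k U (cst a).
Proof.
elim: k a => [|k IH] a; split=> //; try by move=> x _; exact: cst_continuous.
move=> i; split=> [x _|]; first exact: derivable_cst.
rewrite (_ : partial i (cst a) = cst 0); first exact: IH.
by apply/funext => x; exact: derive_cst.
Qed.

Lemma Ck_onB k U f g : open U ->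
  Ck_on k U f -> Ck_on k U g -> Ck_on k U (f - g).
Proof.
move=> oU; elim: k f g => [|k IH] f g [cf df] [cg dg].
  by split=> // x Ux; apply: continuousB; [exact: cf|exact: cg].
split=> [x Ux|i]; first by apply: continuousB; [exact: cf|exact: cg].
have [dfi Cfi] := df i; have [dgi Cgi] := dg i.
split=> [x Ux|]; first by apply: derivableB; [exact: dfi|exact: dgi].
apply: eq_Ck_on (IH _ _ Cfi Cgi) => // x Ux.
by rewrite /partial deriveB//; [exact: dfi|exact: dgi].
Qed.

Lemma Ck_onD k U f g : open U ->
  Ck_on k U f -> Ck_on k U g -> Ck_on k U (f + g).
Proof.
move=> oU Cf Cg; rewrite -[g]opprK -[- g]sub0r.
by do 2?[apply: Ck_onB => //]; exact: Ck_on_cst.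
Qed.

Lemma Ck_onM k U f g : open U ->
  Ck_on k U f -> Ck_on k U g -> Ck_on k U (f * g).
Proof.
move=> oU; elim: k f g => [|k IH] f g Cf Cg.
  by split=> // x Ux; apply: continuousM; [exact: Cf.1|exact: Cg.1].
split=> [x Ux|i]; first by apply: continuousM; [exact: Cf.1|exact: Cg.1].
have [dfi Cfi] := Cf.2 i; have [dgi Cgi] := Cg.2 i.
split=> [x Ux|]; first by apply: derivableM; [exact: dfi|exact: dgi].
apply: (@eq_Ck_on _ _ (f * partial i g + g * partial i f)) => //.
  by move=> x Ux; rewrite /partial deriveM//; [exact: dfi|exact: dgi].
by apply: Ck_onD => //; apply: IH => //; exact: Ck_onW.
Qed.

End SmoothOn.

(* A homeomorphism of an open subset of T onto an open subset of R^n; the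
   values of chart_map and chart_inv outside these sets are irrelevant. *)
Record chart (R : realType) (n : nat) (T : topologicalType) := Chart {
  chart_dom : set T;
  chart_map :> T -> 'rV[R]_n;
  chart_inv : 'rV[R]_n -> T;
  chart_dom_open : open chart_dom;
  chart_img_open : open (chart_map @` chart_dom);
  chart_mapK : forall p, chart_dom p -> chart_inv (chart_map p) = p;
  chart_map_continuous :
    forall p, chart_dom p -> {for p, continuous chart_map};
  chart_inv_continuous :
    forall x, (chart_map @` chart_dom) x -> {for x, continuous chart_inv}
}.

Record smooth_manifold (R : realType) (n : nat) := SmoothManifold {
  manifold_space :> topologicalType;
  manifold_hausdorff : hausdorff_space manifold_space;
  manifold_second_countable : @second_countable manifold_space;
  atlas : set (chart R n manifold_space);
  atlas_cover : forall p, exists2 c, atlas c & chart_dom c p;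
  atlas_compatible : forall c d, atlas c -> atlas d -> forall i : 'I_n,
    smooth_on (c @` (chart_dom c `&` chart_dom d))
      (fun x => d (chart_inv c x) 0 i)
}.

Section SmoothFunctions.
Context {R : realType} {n : nat} (M : smooth_manifold R n).

Definition smooth (f : M -> R) : Prop :=
  forall c, atlas c -> smooth_on (c @` chart_dom c) (f \o chart_inv c).

Definition smooth_mem : {pred M -> R} := fun f => `[< smooth f >].

Record Cinf := MkCinf { Cinf_fun :> M -> R; _ : Cinf_fun \in smooth_mem }.

HB.instance Definition _ := [isSub for Cinf_fun].
HB.instance Definition _ := [Choice of Cinf by <:].

Lemma smooth_subring_closed : subring_closed smooth_mem.
Proof.
split=> [|f g /asboolP sf /asboolP sg|f g /asboolP sf /asboolP sg];
  apply/asboolP => c ac k.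
- exact: (@Ck_on_cst _ _ k _ 1).
- exact: Ck_onB (@chart_img_open _ _ _ c) (sf c ac k) (sg c ac k).
- exact: Ck_onM (@chart_img_open _ _ _ c) (sf c ac k) (sg c ac k).
Qed.

HB.instance Definition _ :=
  GRing.SubChoice_isSubComPzRing.Build (M -> R) smooth_mem Cinf
    smooth_subring_closed.

Lemma Cinf_ext (f g : Cinf) : (forall p, f p = g p) -> f = g.
Proof. by move=> fg; apply/val_inj/funext. Qed.

Lemma Cinf_smooth (f : Cinf) : smooth f.
Proof. by case: f => f /= /asboolP. Qed.

Definition mkCinf (f : M -> R) (sf : smooth f) : Cinf := MkCinf (asboolT sf).

Lemma smooth_cst (a : R) : smooth (cst a).
Proof. by move=> c _ k; exact: Ck_on_cst. Qed.

Definition Ccst (a : R) : Cinf := mkCinf (smooth_cst a).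

Lemma CinfDE (f g : Cinf) p : (f + g) p = f p + g p. Proof. by []. Qed.
Lemma CinfNE (f : Cinf) p : (- f) p = - f p. Proof. by []. Qed.
Lemma CinfME (f g : Cinf) p : (f * g) p = f p * g p. Proof. by []. Qed.
Lemma Cinf0E p : (0 : Cinf) p = 0. Proof. by []. Qed.
Lemma Cinf1E p : (1 : Cinf) p = 1. Proof. by []. Qed.

Lemma smoothM (f g : Cinf) : smooth (fun p => f p * g p).
Proof. exact: Cinf_smooth (f * g). Qed.

End SmoothFunctions.

Section VectorFields.
Context {R : realType} {n : nat} (M : smooth_manifold R n).

(* Tangent vectors at p are the derivations of C^oo(M) at p. *)
Definition is_tangent (p : M) (v : Cinf M -> R) : Prop :=
  (forall (a : R) (f g : Cinf M), v (Ccst M a * f + g) = a * v f + v g) /\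
  (forall f g : Cinf M, v (f * g) = v f * g p + f p * v g).

Definition is_vfield (X : M -> Cinf M -> R) : Prop :=
  (forall p, is_tangent p (X p)) /\ (forall f, smooth (fun p => X p f)).

Definition vfield_mem : {pred M -> Cinf M -> R} := fun X => `[< is_vfield X >].

Record vfield :=
  MkVfield { vfield_at :> M -> Cinf M -> R; _ : vfield_at \in vfield_mem }.

HB.instance Definition _ := [isSub for vfield_at].
HB.instance Definition _ := [Choice of vfield by <:].

Definition mkVfield X (vX : is_vfield X) : vfield := MkVfield (asboolT vX).

Lemma vfieldP (X : vfield) : is_vfield X.
Proof. by case: X => X /= /asboolP. Qed.

Lemma vfield_ext (X Y : vfield) : (forall p f, X p f = Y p f) -> X = Y.
Proof. by move=> XY; apply/val_inj/funext => p; apply/funext => f. Qed.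

Definition vapp (X : vfield) (f : Cinf M) : Cinf M := mkCinf ((vfieldP X).2 f).

Lemma vfield_zmod_closed : zmod_closed vfield_mem.
Proof.
split=> [|X Y /asboolP[tX sX] /asboolP[tY sY]]; apply/asboolP; split.
- by move=> p; split=> *; rewrite /GRing.zero /= ?(mulr0, mul0r, addr0).
- by move=> f; exact: smooth_cst.
- move=> p; have [lX dX] := tX p; have [lY dY] := tY p.
  split=> [a f g|f g]; rewrite !fctE.
    by rewrite lX lY mulrBr opprD addrACA.
  by rewrite dX dY mulrBl mulrBr opprD addrACA.
- by move=> f; exact: Cinf_smooth (mkCinf (sX f) - mkCinf (sY f)).
Qed.

HB.instance Definition _ :=
  GRing.SubChoice_isSubZmodule.Build (M -> Cinf M -> R) vfield_mem vfield
    vfield_zmod_closed.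

Lemma is_vfieldZ (h : Cinf M) (X : vfield) :
  is_vfield (fun p f => h p * X p f).
Proof.
have [tX sX] := vfieldP X; split=> [p|f].
  have [lX dX] := tX p.
  split=> [a f g|f g]; first by rewrite lX mulrDr mulrCA.
  by rewrite dX mulrDr mulrA [h p * (f p * _)]mulrCA.
exact: smoothM h (vapp X f).
Qed.

Definition vscale (h : Cinf M) (X : vfield) : vfield :=
  mkVfield (is_vfieldZ h X).

Fact vscaleA h k X : vscale h (vscale k X) = vscale (h * k) X.
Proof. by apply: vfield_ext => p f /=; rewrite mulrA. Qed.
Fact vscale1 : left_id 1 vscale.
Proof. by move=> X; apply: vfield_ext => p f /=; rewrite mul1r. Qed.
Fact vscaleDr : right_distributive vscale +%R.
Proof. by move=> h X Y; apply: vfield_ext => p f /=; rewrite mulrDr. Qed.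
Fact vscaleDl X : {morph vscale^~ X : h k / h + k}.
Proof. by move=> h k; apply: vfield_ext => p f /=; rewrite mulrDl. Qed.

HB.instance Definition _ :=
  GRing.Zmodule_isLmodule.Build (Cinf M) vfield
    vscaleA vscale1 vscaleDr vscaleDl.

Lemma vappE X f p : vapp X f p = X p f. Proof. by []. Qed.
Lemma vfieldZE h X p f : (h *: X : vfield) p f = h p * X p f.
Proof. by []. Qed.
Lemma vfieldDE (X Y : vfield) p f : (X + Y) p f = X p f + Y p f.
Proof. by []. Qed.
Lemma vfieldNE (X : vfield) p f : (- X) p f = - X p f.
Proof. by []. Qed.

Lemma vapp_lin X a f g :
  vapp X (Ccst M a * f + g) = Ccst M a * vapp X f + vapp X g.
Proof. by apply: Cinf_ext => p; have [/(_ p)[+ _] _] := vfieldP X; apply. Qed.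

Lemma vappM X f g : vapp X (f * g) = vapp X f * g + f * vapp X g.
Proof. by apply: Cinf_ext => p; have [/(_ p)[_ +] _] := vfieldP X; apply. Qed.

Lemma vappD X f g : vapp X (f + g) = vapp X f + vapp X g.
Proof.
have -> : f + g = Ccst M 1 * f + g.
  by congr (_ + _); apply: Cinf_ext => p; rewrite CinfME mul1r.
by rewrite vapp_lin; congr (_ + _); apply: Cinf_ext => p; rewrite CinfME mul1r.
Qed.

Lemma is_vfield_bracket (X Y : vfield) :
  is_vfield (fun p f => X p (vapp Y f) - Y p (vapp X f)).
Proof.
have [tX _] := vfieldP X; have [tY _] := vfieldP Y.
split=> [p|f]; last first.
  exact: Cinf_smooth (vapp X (vapp Y f) - vapp Y (vapp X f)).
have [lX dX] := tX p; have [lY dY] := tY p; split=> [a f g|f g].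
  by rewrite !vapp_lin lX lY mulrBr opprD addrACA.
rewrite -!vappE !vappM !vappD !vappM !CinfDE !CinfME.
by ring.
Qed.

Definition bracket (X Y : vfield) : vfield := mkVfield (is_vfield_bracket X Y).

End VectorFields.

(* Tensor fields are C^oo(M)-multilinear maps on vector fields. *)

Record riemannian_metric (R : realType) (n : nat) (M : smooth_manifold R n) :=
  RiemannianMetric {
  metric :> vfield M -> vfield M -> Cinf M;
  metric_linear : forall (f : Cinf M) (X Y Z : vfield M),
    metric (f *: X + Y) Z = f * metric X Z + metric Y Z;
  metric_sym : forall X Y : vfield M, metric X Y = metric Y X;
  metric_pos : forall (X : vfield M) (p : M),
    (exists f, X p f != 0) -> 0 < metric X X p
}.

Record levi_civita (R : realType) (n : nat) (M : smooth_manifold R n)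
    (g : riemannian_metric M) := LeviCivita {
  nabla :> vfield M -> vfield M -> vfield M;
  nabla_linearl : forall (f : Cinf M) (X Y Z : vfield M),
    nabla (f *: X + Y) Z = f *: nabla X Z + nabla Y Z;
  nablaDr : forall X Y Z : vfield M, nabla X (Y + Z) = nabla X Y + nabla X Z;
  nabla_leibniz : forall (f : Cinf M) (X Y : vfield M),
    nabla X (f *: Y) = vapp X f *: Y + f *: nabla X Y;
  nabla_torsion : forall X Y : vfield M, nabla X Y - nabla Y X = bracket X Y;
  nabla_metric : forall X Y Z : vfield M,
    vapp X (g Y Z) = g (nabla X Y) Z + g Y (nabla X Z)
}.

Definition curvature (R : realType) (n : nat) (M : smooth_manifold R n)
    (g : riemannian_metric M) (D : levi_civita g) (X Y Z : vfield M) :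
    vfield M :=
  D X (D Y Z) - D Y (D X Z) - D (bracket X Y) Z.

Definition curvature4 (R : realType) (n : nat) (M : smooth_manifold R n)
    (g : riemannian_metric M) (D : levi_civita g) (X Y Z W : vfield M) :
    Cinf M :=
  g (curvature D X Y Z) W.

Record almost_contact_metric (R : realType) (n : nat)
    (M : smooth_manifold R n) := AlmostContactMetric {
  acm_phi : {linear vfield M -> vfield M};
  acm_xi : vfield M;
  acm_eta : {scalar vfield M};
  acm_g : riemannian_metric M;
  acm_dim_odd : odd n;
  acm_eta_xi : acm_eta acm_xi = 1;
  acm_phi2 : forall X : vfield M,
    acm_phi (acm_phi X) = - X + acm_eta X *: acm_xi;
  acm_g_phi : forall X Y : vfield M,
    acm_g (acm_phi X) (acm_phi Y) = acm_g X Y - acm_eta X * acm_eta Y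
}.

Section AlmostContact.
Context {R : realType} {n : nat} {M : smooth_manifold R n}.
Variable S : almost_contact_metric M.
Implicit Types X Y Z W : vfield M.

Local Notation phi := (acm_phi S).
Local Notation xi := (acm_xi S).
Local Notation eta := (acm_eta S).
Local Notation g := (acm_g S).

(* Convention: 2 d eta(X, Y) = X eta(Y) - Y eta(X) - eta([X, Y]). *)
Definition acm_deta X Y : Cinf M :=
  Ccst M 2^-1 *
    (vapp X (eta Y : Cinf M) - vapp Y (eta X : Cinf M) - eta (bracket X Y)).

Definition contact_metric : Prop := forall X Y, acm_deta X Y = g X (phi Y).

Definition acm_lie_xi_phi X : vfield M :=
  bracket xi (phi X) - phi (bracket xi X).

Definition acm_h X : vfield M := Ccst M 2^-1 *: acm_lie_xi_phi X.

Local Notation h := acm_h.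

Definition acm_P X Y Z W : Cinf M :=
  g X (phi Z) * g Y W - g X (phi W) * g Y Z
  - g Y (phi Z) * g X W + g Y (phi W) * g X Z.

Definition acm_R1 X Y Z : vfield M := g Y Z *: X - g X Z *: Y.

Definition acm_R2 X Y Z : vfield M :=
  g X (phi Z) *: phi Y - g Y (phi Z) *: phi X + (2 * g X (phi Y)) *: phi Z.

Definition acm_R3 X Y Z : vfield M :=
  (eta X * eta Z) *: Y - (eta Y * eta Z) *: X
  + (g X Z * eta Y) *: xi - (g Y Z * eta X) *: xi.

Definition acm_R4 X Y Z : vfield M :=
  g Y Z *: h X - g X Z *: h Y + g (h Y) Z *: X - g (h X) Z *: Y.

Definition acm_R5 X Y Z : vfield M :=
  g (h Y) Z *: h X - g (h X) Z *: h Y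
  + g (phi (h X)) Z *: phi (h Y) - g (phi (h Y)) Z *: phi (h X).

Definition acm_R6 X Y Z : vfield M :=
  (eta X * eta Z) *: h Y - (eta Y * eta Z) *: h X
  + (g (h X) Z * eta Y) *: xi - (g (h Y) Z * eta X) *: xi.

(* D is the Levi-Civita connection of g, so the left-hand side is the Riemann
   curvature of the metric. *)
Definition gen_kappa_mu_space_form (D : levi_civita g)
    (f1 f2 f3 f4 f5 f6 : Cinf M) : Prop :=
  forall X Y Z,
    curvature D X Y Z =
      f1 *: acm_R1 X Y Z + f2 *: acm_R2 X Y Z + f3 *: acm_R3 X Y Z
      + f4 *: acm_R4 X Y Z + f5 *: acm_R5 X Y Z + f6 *: acm_R6 X Y Z.

End AlmostContact.

(* Main.v *)
Require Import Defs.
From mathcomp Require Import all_boot all_order all_algebra.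
From mathcomp Require Import all_classical all_reals all_analysis.
Import Order.TTheory GRing.Theory Num.Theory.
From mathcomp Require Import ring.
Local Open Scope ring_scope.

(** In a contact metric manifold [L_xi eta = 0] and [L_xi (d eta) = 0]. Taking
    the Lie derivative along [xi] of [phi^2 = - id + eta (x) xi] and of
    [g (phi X) (phi Y) = d eta (phi X, Y)] shows that [h] anticommutes with
    [phi], is self-adjoint, and has image orthogonal to [xi]. With these rules
    and the skewness of [phi], both sides of the identity become polynomials
    in the functions [f_i] and the products of [X], [Y] with each other and
    with their images by [phi], [h] and [phi h]. *)

(** * Derivations and the Lie bracket *)

Section Bracket.
Context {R : realType} {n : nat} {M : smooth_manifold R n}.
Implicit Types (X Y Z : vfield M) (f : Cinf M).

Lemma vapp0 X : vapp X 0 = 0.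
Proof. by apply: (addrI (vapp X 0)); rewrite -vappD !addr0. Qed.

Lemma vappN X f : vapp X (- f) = - vapp X f.
Proof. by apply: (addrI (vapp X f)); rewrite -vappD !subrr vapp0. Qed.

Lemma vappB X f1 f2 : vapp X (f1 - f2) = vapp X f1 - vapp X f2.
Proof. by rewrite vappD vappN. Qed.

Lemma vappZ X (a : R) f : vapp X (Ccst M a * f) = Ccst M a * vapp X f.
Proof. by rewrite -[_ * f]addr0 vapp_lin vapp0 addr0. Qed.

Lemma vapp1 X : vapp X 1 = 0.
Proof.
apply: (addrI (vapp X 1)).
by rewrite addr0 -{3}[1]mulr1 vappM mulr1 mul1r.
Qed.

Lemma vapp_bracket X Y f :
  vapp (bracket X Y) f = vapp X (vapp Y f) - vapp Y (vapp X f).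
Proof. exact: Cinf_ext. Qed.

(** Reduces identities between fields to identities in the commutative ring [Cinf M], where [ring]
    applies. *)
Lemma vapp_ext X Y : (forall f, vapp X f = vapp Y f) -> X = Y.
Proof. by move=> XY; apply: vfield_ext => p f; rewrite -!vappE XY. Qed.

Lemma vapp_vfieldD X Y f : vapp (X + Y) f = vapp X f + vapp Y f.
Proof. exact: Cinf_ext. Qed.

Lemma vapp_vfieldN X f : vapp (- X) f = - vapp X f.
Proof. exact: Cinf_ext. Qed.

Lemma vapp_vfieldZ k X f : vapp (k *: X) f = k * vapp X f.
Proof. exact: Cinf_ext. Qed.

Lemma bracketDr X Y Z : bracket X (Y + Z) = bracket X Y + bracket X Z.
Proof.
apply: vapp_ext => f; rewrite vapp_vfieldD !vapp_bracket !vapp_vfieldD vappD.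
by ring.
Qed.

Lemma bracketNr X Y : bracket X (- Y) = - bracket X Y.
Proof.
apply: vapp_ext => f; rewrite vapp_vfieldN !vapp_bracket !vapp_vfieldN vappN.
by ring.
Qed.

Lemma bracketZr k X Y :
  bracket X (k *: Y) = vapp X k *: Y + k *: bracket X Y.
Proof.
apply: vapp_ext => f.
rewrite vapp_vfieldD !vapp_vfieldZ !vapp_bracket !vapp_vfieldZ vappM.
by ring.
Qed.

Lemma bracketxx X : bracket X X = 0.
Proof. by apply: vfield_ext => p f /=; rewrite subrr. Qed.

Lemma bracket_jacobi X Y Z :
  bracket X (bracket Y Z)
  = bracket (bracket X Y) Z + bracket Y (bracket X Z).
Proof.
apply: vapp_ext => f; rewrite vapp_vfieldD !vapp_bracket !vappB.
by ring.
Qed.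

End Bracket.

(** * Bilinearity of the metric *)

Section Metric.
Context {R : realType} {n : nat} {M : smooth_manifold R n}.
Variable g : riemannian_metric M.
Implicit Types (X Y Z : vfield M) (f : Cinf M).

(* [metric_sym] alone denotes the homonymous lemma of MathComp-Analysis *)
Lemma metricC X Y : g X Y = g Y X.
Proof. exact: Defs.metric_sym. Qed.

Lemma metricDl X Y Z : g (X + Y) Z = g X Z + g Y Z.
Proof. by rewrite -[X]scale1r metric_linear mul1r scale1r. Qed.

Lemma metric0l Z : g 0 Z = 0.
Proof. by apply: (addrI (g 0 Z)); rewrite -metricDl !addr0. Qed.

Lemma metricZl f X Z : g (f *: X) Z = f * g X Z.
Proof. by rewrite -[f *: X]addr0 metric_linear metric0l addr0. Qed.

Lemma metricNl X Z : g (- X) Z = - g X Z.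
Proof. by apply: (addrI (g X Z)); rewrite -metricDl !subrr metric0l. Qed.

Lemma metric0r Z : g Z 0 = 0.
Proof. by rewrite metricC metric0l. Qed.

Lemma metricDr X Y Z : g X (Y + Z) = g X Y + g X Z.
Proof. by rewrite metricC metricDl !(metricC _ X). Qed.

Lemma metricZr f X Z : g X (f *: Z) = f * g X Z.
Proof. by rewrite metricC metricZl metricC. Qed.

Lemma metricNr X Z : g X (- Z) = - g X Z.
Proof. by rewrite metricC metricNl metricC. Qed.

End Metric.

(** Functions take values in a field, so there are no nilpotents. *)
Lemma Cinf_sqr_eq0 {R : realType} {n : nat} {M : smooth_manifold R n}
  (f : Cinf M) : f * f = 0 -> f = 0.
Proof.
move=> ff0; apply: Cinf_ext => p; apply/eqP.
by have /eqP := congr1 (fun k : Cinf M => k p) ff0; rewrite mulf_eq0 orbb.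
Qed.

(** * Algebra of an almost contact metric structure *)

Section AlmostContactTheory.
Context {R : realType} {n : nat} {M : smooth_manifold R n}.
Variable S : almost_contact_metric M.
Implicit Types X Y Z : vfield M.

Local Notation phi := (acm_phi S).
Local Notation xi := (acm_xi S).
Local Notation eta := (acm_eta S).
Local Notation g := (acm_g S).
Local Notation h := (acm_h S).

Lemma acm_etaZ (f : Cinf M) X : eta (f *: X) = f * eta X.
Proof. by rewrite linearZ. Qed.

Lemma acm_phi_xi : phi xi = 0.
Proof.
have p2 : phi (phi xi) = 0 by rewrite acm_phi2 acm_eta_xi scale1r addNr.
(* The formula for [phi^2] at [phi xi] gives [phi xi = k xi] with [k = eta (phi xi)]; then
   [0 = phi^2 xi = k^2 xi] forces [k = 0]. *)
have : phi (phi (phi xi)) = 0 by rewrite p2 linear0.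
rewrite acm_phi2 => /eqP; rewrite addrC subr_eq0 eq_sym => /eqP.
move: (eta _) => k p1; move: p2.
rewrite p1 linearZ /= p1 scalerA => /(congr1 eta).
rewrite acm_etaZ acm_eta_xi mulr1 linear0 => /Cinf_sqr_eq0 ->.
by rewrite scale0r.
Qed.

Lemma acm_g_xi X : g X xi = eta X.
Proof.
have := acm_g_phi S X xi.
rewrite acm_phi_xi metric0r acm_eta_xi mulr1 => /esym/eqP.
by rewrite subr_eq0 => /eqP.
Qed.

(** Compare [phi (phi^2 X)] with [phi^2 (phi X)]: they differ by [eta (phi X) xi]. *)
Lemma acm_eta_phi X : eta (phi X) = 0.
Proof.
have := congr1 phi (acm_phi2 S X).
rewrite acm_phi2 linearD linearN linearZ /= acm_phi_xi scaler0.
by move=> /addrI /(congr1 eta); rewrite acm_etaZ acm_eta_xi mulr1 linear0.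
Qed.

Lemma acm_g_phi_skew X Y : g (phi X) Y = - g X (phi Y).
Proof.
have := acm_g_phi S X (phi Y).
rewrite acm_phi2 metricDr metricNr metricZr acm_g_xi !acm_eta_phi.
by rewrite !mulr0 subr0 addr0 => <-; rewrite opprK.
Qed.

Lemma acm_g_phi_diag X : g X (phi X) = 0.
Proof.
have e : g X (phi X) = - g X (phi X) by rewrite -acm_g_phi_skew metricC.
apply: Cinf_ext => p; apply/eqP; rewrite -eqNr.
by rewrite -CinfNE -e.
Qed.

(** * Consequences of the contact condition for [L_xi phi] and [h] *)

Hypothesis contact : contact_metric S.

(* [L_xi eta = 0] *)
Lemma contact_xi_eta X : vapp xi (eta X : Cinf M) = eta (bracket xi X).
Proof.
(* Here [d eta (xi, X) = eta (phi X) = 0]; the factor 2 clears the one half in the convention for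
   [d eta]. *)
have := contact xi X; rewrite /acm_deta metricC acm_g_xi acm_eta_phi.
rewrite acm_eta_xi vapp1 subr0 => /(congr1 ( *%R (Ccst M 2))).
rewrite mulr0 mulrA.
have -> : Ccst M 2 * Ccst M 2^-1 = 1.
  by apply: Cinf_ext => p; rewrite CinfME /= divff// pnatr_eq0.
by rewrite mul1r => /eqP; rewrite subr_eq0 => /eqP.
Qed.

(* [L_xi (d eta) = 0] *)
Lemma contact_xi_deta X Y :
  vapp xi (g X (phi Y)) = g (bracket xi X) (phi Y) + g X (phi (bracket xi Y)).
Proof.
(* [L_xi] passes through [eta] by the previous lemma and through the bracket by Jacobi. *)
rewrite -!contact /acm_deta vappZ !vappB contact_xi_eta bracket_jacobi.
rewrite !vapp_bracket linearD /= -!contact_xi_eta.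
by ring.
Qed.

Local Notation L := (acm_lie_xi_phi S).

Lemma eta_lie_xi_phi X : eta (L X) = 0.
Proof.
rewrite /acm_lie_xi_phi linearB /= -contact_xi_eta !acm_eta_phi vapp0.
by rewrite subr0.
Qed.

(* Lie derivative along [xi] of [phi^2 = - id + eta (x) xi] *)
Lemma lie_xi_phi_anticomm X : L (phi X) = - phi (L X).
Proof.
apply/eqP; rewrite -addr_eq0 /acm_lie_xi_phi linearB /= addrA subrK.
rewrite !acm_phi2 bracketDr bracketNr bracketZr bracketxx scaler0 addr0.
by rewrite contact_xi_eta subrr.
Qed.

(* Lie derivative along [xi] of the symmetric form [g (phi X) (phi Y)] *)
Lemma g_lie_xi_phi X Y : g (L X) (phi Y) = g (L Y) (phi X).
Proof.
(* All but the left-hand side is visibly symmetric in [Z] and [W]. *)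
have E Z W : g (L Z) (phi W) = vapp xi (g (phi Z) (phi W))
    - g (phi (bracket xi Z)) (phi W) - g (phi Z) (phi (bracket xi W)).
  by rewrite contact_xi_deta /acm_lie_xi_phi metricDl metricNl; ring.
by rewrite !E !(metricC _ (phi Y)) (metricC _ (phi (bracket xi Y))); ring.
Qed.

(** Put [phi Y] for [Y] in [g_lie_xi_phi]; anticommutation and [eta (L X) = 0] remove every
    [phi]. *)
Lemma lie_xi_phi_sym X Y : g (L X) Y = g X (L Y).
Proof.
have := g_lie_xi_phi X (phi Y).
rewrite lie_xi_phi_anticomm acm_phi2 metricDr metricZr !metricNr metricNl.
rewrite acm_g_xi acm_g_phi !eta_lie_xi_phi mulr0 mul0r addr0 subr0.
by move=> /oppr_inj ->; rewrite metricC.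
Qed.

Lemma eta_h X : eta (h X) = 0.
Proof. by rewrite acm_etaZ eta_lie_xi_phi mulr0. Qed.

Lemma h_anticomm X : h (phi X) = - phi (h X).
Proof. by rewrite /acm_h lie_xi_phi_anticomm linearZ scalerN. Qed.

Lemma h_sym X Y : g (h X) Y = g X (h Y).
Proof. by rewrite metricZl metricZr lie_xi_phi_sym. Qed.

End AlmostContactTheory.

(** * The curvature identity on fields orthogonal to [xi] *)

Theorem proposition3p13 (R : realType) (n : nat) (M : smooth_manifold R n)
    (S : almost_contact_metric M) (D : levi_civita (acm_g S))
    (f1 f2 f3 f4 f5 f6 : Cinf M) :
  gen_kappa_mu_space_form D f1 f2 f3 f4 f5 f6 ->
  contact_metric S ->
  forall X Y : vfield M,
    acm_g S X (acm_xi S) = 0 -> acm_g S Y (acm_xi S) = 0 ->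
    let phi := acm_phi S in
    let h := acm_h S in
    let P := acm_P S in
    let Riem := curvature4 D in
    Riem X (phi X) Y (phi Y) =
      Riem X Y X Y + Riem X (phi Y) X (phi Y)
      - 2 * (f1 - f2) * P X Y X (phi Y)
      - 2 * f4 * P X Y (h X) (phi Y).
Proof.
move=> space_form contact X Y; rewrite !acm_g_xi => eX eY phi h P Riem.
set g := acm_g S.
have phi2 Z : acm_eta S Z = 0 -> phi (phi Z) = - Z.
  by move=> eZ; rewrite /phi acm_phi2 eZ scale0r addr0.
have eh Z : acm_eta S (h Z) = 0 by exact: eta_h.
have g_phi2 Z W : acm_eta S Z = 0 -> g (phi Z) (phi W) = g Z W.
  by move=> eZ; rewrite /g /phi acm_g_phi eZ mul0r subr0.
have gphi Z W : g (phi Z) W = - g Z (phi W) by exact: acm_g_phi_skew.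
have hphi Z : h (phi Z) = - phi (h Z) by exact: h_anticomm.
have hs Z W : g (h Z) W = g Z (h W) by exact: h_sym.
have gC Z W : g Z W = g W Z by exact: metricC.
have gZphiZ Z : g Z (phi Z) = 0 by exact: acm_g_phi_diag.
(* Normal form: mixed products are written with [X] on the left, so that equal products become equal
   atoms for [ring]. *)
have gYX : g Y X = g X Y by exact: gC.
have gYphiX : g Y (phi X) = - g X (phi Y) by rewrite gC gphi.
have gYhX : g Y (h X) = g X (h Y) by rewrite gC hs.
have gYphihX : g Y (phi (h X)) = g X (phi (h Y)).
  by rewrite gC gphi hs hphi metricNr opprK.
rewrite /Riem /curvature4 !space_form -/g.
rewrite /acm_R1 /acm_R2 /acm_R3 /acm_R4 /acm_R5 /acm_R6 /P /acm_P -/g -/phi -/h.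
(* All arguments are orthogonal to [xi], so each term of [acm_R3] and [acm_R6] gets a zero
   factor. *)
rewrite !acm_eta_phi eX eY => {P Riem space_form}.
clearbody phi h g.
rewrite !(metricDl, metricNl, metricZl) !(hphi, linearN) /= ?phi2 //.
rewrite !(metricNl, metricNr, g_phi2, gphi, hs) //.
rewrite !(hphi, phi2, metricNr, linearN) //=.
rewrite !(phi2, metricNr, gZphiZ, gYX, gYphiX, gYhX, gYphihX) //.
by ring.
Qed.
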